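(* Let $R_1,\ldots,R_{p+1}\in gl(n,{\bf C})$. The $(p+1)$-tuple $(R_1,\ldots,R_{p+1})$ has trivial centralizer if and only if the linear map $$(gl(n,{\bf C}))^{p+1}\to sl(n,{\bf C}),\qquad (X_1,\ldots,X_{p+1})\mapsto\sum_{j=1}^{p+1}[R_j,X_j]$$ is surjective.
   Context: Here $[A,B]=AB-BA$. The centralizer of a $(p+1)$-tuple of $n\times n$ matrices is the set of matrices commuting with all matrices of the tuple; it is called trivial if it consists only of scalar matrices. *)

(* Defs.v *)
From HB Require Import structures.
From mathcomp Require Import all_boot all_order all_algebra.
From mathcomp Require Import reals.
From mathcomp Require Export complex.

Set Implicit Arguments.
Unset Strict Implicit.
Unset Printing Implicit Defensive.

Import GRing.Theory.
Local Open Scope ring_scope.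

Section Commutators.
Variables (F : fieldType) (n : nat).

Definition commutator (A B : 'M[F]_n) : 'M[F]_n := A *m B - B *m A.

Definition traceless : {pred 'M[F]_n} := fun A => \tr A == 0.

Lemma traceless_submod_closed : submod_closed traceless.
Proof.
split; first by rewrite /traceless unfold_in mxtrace0.
move=> a A B /eqP trA /eqP trB.
by rewrite /traceless unfold_in mxtraceD mxtraceZ trA trB mulr0 addr0.
Qed.

HB.instance Definition _ :=
  GRing.isSubmodClosed.Build F 'M[F]_n traceless traceless_submod_closed.

Record sl : predArgType := Sl { sl_val :> 'M[F]_n; _ : sl_val \in traceless }.

HB.instance Definition _ := [isSub for sl_val].
HB.instance Definition _ := [Choice of sl by <:].
HB.instance Definition _ := [SubChoice_isSubLmodule of sl by <:].

Variable p : nat.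
Implicit Types R X : {ffun 'I_p.+1 -> 'M[F]_n}.

(* The centralizer of a tuple is taken in the whole matrix algebra: its
   elements need not be invertible. *)
Definition centralizer R : {pred 'M[F]_n} :=
  fun A => [forall j, comm_mxb A (R j)].

Definition trivial_centralizer R : Prop :=
  {in centralizer R, forall A, is_scalar_mx A}.

Lemma sum_commutator_traceless R X :
  \sum_j commutator (R j) (X j) \in traceless.
Proof.
rewrite unfold_in raddf_sum big1 // => j _ /=.
by rewrite /commutator raddfB /= mxtrace_mulC subrr.
Qed.

Definition commutator_map R X : sl := Sl (sum_commutator_traceless R X).

Lemma commutator_map_is_linear R : linear (commutator_map R).
Proof.
move=> a X Y; apply: val_inj => /=.
rewrite scaler_sumr -big_split /=; apply: eq_bigr => j _.
rewrite !ffunE /commutator mulmxDr mulmxDl -scalemxAr -scalemxAl scalerBr.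
by rewrite opprD addrACA.
Qed.

HB.instance Definition _ R :=
  GRing.isLinear.Build F {ffun 'I_p.+1 -> 'M[F]_n} sl _ (commutator_map R)
    (commutator_map_is_linear R).

End Commutators.

(* Main.v *)
Require Import Defs.
From HB Require Import structures.
From mathcomp Require Import all_boot all_order all_algebra.
From mathcomp Require Import reals.
From mathcomp Require Import complex.

Import GRing.Theory.
Local Open Scope ring_scope.

(** The trace form (A, B) |-> \tr (A *m B) is nondegenerate and satisfies
    \tr (A *m [R, X]) = \tr ([A, R] *m X).  Hence the centralizer of the tuple
    is the orthogonal complement of the span of the images of the maps
    X |-> [R_j, X], whereas the scalar matrices form the orthogonal complement
    of the traceless ones. *)

Section TraceForm.
Variables (F : fieldType) (n : nat).
Implicit Types A B R X Y Z : 'M[F]_n.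

Lemma mxtrace_mul_delta A (i j : 'I_n) : \tr (A *m delta_mx i j) = A j i.
Proof.
rewrite /mxtrace (bigD1 j) //= big1 ?addr0 => [|k k_j]; rewrite mxE.
  rewrite (bigD1 i) //= big1 ?addr0 => [|l l_i]; rewrite mxE ?eqxx ?mulr1 //.
  by rewrite (negPf l_i) mulr0.
by rewrite big1 // => l _; rewrite mxE (negPf k_j) andbF mulr0.
Qed.

Lemma mxtrace_mul_eq0 A : (forall X, \tr (A *m X) = 0) -> A = 0.
Proof. by move=> A0; apply/matrixP=> i j; rewrite -mxtrace_mul_delta A0 mxE. Qed.

(** Bridges row-space computations on vectorised matrices and the trace form. *)
Lemma mxvec_dot_trmx A B : mxvec A *m (mxvec B)^T = (\tr (A *m B^T))%:M.
Proof.
apply/matrixP=> i j; rewrite !ord1 [RHS]mxE eqxx mulr1n mxE.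
rewrite (reindex _ (curry_mxvec_bij _ _)) /=.
transitivity (\sum_k \sum_l A k l * B k l).
  rewrite pair_bigA /=; apply: eq_bigr => -[k l] _ /=.
  by rewrite mxE !mxvecE.
by apply: eq_bigr => k _; rewrite mxE; apply: eq_bigr => l _; rewrite mxE.
Qed.

Lemma mxtrace_mul_commutator A R X :
  \tr (A *m commutator R X) = \tr (commutator A R *m X).
Proof.
rewrite /commutator mulmxBr mulmxBl !raddfB /= !mulmxA; congr (_ - _).
by rewrite mxtrace_mulC mulmxA.
Qed.

(** Testing against off-diagonal matrix units kills the off-diagonal entries; testing against
    differences of diagonal units equates the diagonal ones. *)
Lemma traceless_orthogonal_scalar A :
  (forall Y, \tr Y = 0 -> \tr (A *m Y) = 0) -> is_scalar_mx A.
Proof.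
move=> A0; apply/is_scalar_mxP; have [i0 _|no_i] := pickP (@predT 'I_n); last first.
  (* Here [n = 0]: there is no diagonal entry to take as the scalar, and any value works. *)
  by exists 0; apply/matrixP=> i; have := no_i i.
have trD (i j : 'I_n) : \tr (delta_mx i j : 'M[F]_n) = (i == j)%:R.
  by rewrite -[delta_mx i j]mul1mx mxtrace_mul_delta mxE eq_sym.
exists (A i0 i0); apply/matrixP=> i j; rewrite mxE.
have [<-|i_j] := eqVneq i j.
  have := A0 (delta_mx i i - delta_mx i0 i0).
  rewrite mulmxBr !raddfB /= !trD !mxtrace_mul_delta !eqxx subrr.
  by move/(_ erefl)/subr0_eq.
by rewrite -[A i j]mxtrace_mul_delta A0 // trD eq_sym (negPf i_j).
Qed.

(** Double orthogonality: the row space of [S] is cut out by the columns of [cokermx S], and each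
    column is a trace functional. *)
Lemma submx_mxvec_orthogonal m (S : 'M[F]_(m, n * n)) Y :
  (forall A, (forall Z, (mxvec Z <= S)%MS -> \tr (Z *m A) = 0) ->
    \tr (Y *m A) = 0) ->
  (mxvec Y <= S)%MS.
Proof.
move=> SY; rewrite submxE; apply/eqP/row_matrixP => i.
rewrite row0; apply/rowP => k; rewrite !mxE.
pose B := vec_mx (col k (cokermx S))^T.
have dotB Z : (mxvec Z *m cokermx S) 0 k = \tr (Z *m B^T).
  have := mxvec_dot_trmx Z B; rewrite /B vec_mxK trmxK.
  move/matrixP/(_ 0 0); rewrite -/B [RHS]mxE eqxx mulr1n => <-.
  by rewrite !mxE; apply: eq_bigr => l _; rewrite !mxE.
have := dotB Y; rewrite SY => [|Z]; last first.
  by rewrite submxE => /eqP S0; rewrite -dotB S0 mxE.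
by rewrite mxE ord1.
Qed.

(** Lets [mul_vec_lin] apply, so that [lin_mx (commutator R)] has the vectorised commutators with
    [R] as its row space. *)
Lemma commutator_linear R : linear (commutator R).
Proof.
move=> a X Y; rewrite /commutator mulmxDr mulmxDl -scalemxAr -scalemxAl.
by rewrite scalerBr opprD addrACA.
Qed.

HB.instance Definition _ R :=
  GRing.isLinear.Build F 'M[F]_n 'M[F]_n _ (commutator R) (commutator_linear R).

End TraceForm.

Lemma trivial_centralizer_surjective (F : fieldType) (n p : nat)
    (R : {ffun 'I_p.+1 -> 'M[F]_n}) :
  trivial_centralizer R <->
  (forall Y : sl F n, exists X, commutator_map R X = Y).
Proof.
split=> [trivR Y | surjR A /forallP/= cRA].
  pose S := (\sum_j lin_mx (commutator (R j)))%MS.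
  have : (mxvec (sl_val Y) <= S)%MS.
    apply: submx_mxvec_orthogonal => A SA.
    (* Orthogonality to [S] moves across the trace form to [\tr (commutator A (R j) *m X) = 0] for
       all [X]; nondegeneracy then gives commutation. *)
    have /trivR/is_scalar_mxP[a ->] : A \in centralizer R.
      apply/forallP => j; apply/eqP/subr0_eq/mxtrace_mul_eq0 => X.
      rewrite -/(commutator A (R j)) -mxtrace_mul_commutator mxtrace_mulC SA //.
      by rewrite -mul_vec_lin (submx_trans (submxMl _ _)) ?(sumsmx_sup j).
    by rewrite mul_mx_scalar mxtraceZ (eqP (valP Y : \tr _ == 0)) mulr0.
  (* The coefficient rows of [mxvec Y] in the sum [S], reshaped into matrices, form a preimage. *)
  case/sub_sumsmxP => u Yu; exists [ffun j => vec_mx (u j)].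
  apply/val_inj/(can_inj mxvecK); rewrite /= Yu raddf_sum /=.
  by apply: eq_bigr => j _; rewrite ffunE -mul_vec_lin vec_mxK.
(* By surjectivity a traceless [Y] is a sum of commutators with the [R j], to which any centralizing
   [A] is orthogonal. *)
apply: traceless_orthogonal_scalar => Y /eqP trY.
have [X /(congr1 (@sl_val _ _)) /= <-] := surjR (Sl (trY : Y \in @traceless F n)).
rewrite mulmx_sumr raddf_sum big1 // => j _ /=.
rewrite mxtrace_mul_commutator /commutator.
by rewrite (eqP (cRA j : _ == _)) subrr mul0mx mxtrace0.
Qed.

Theorem proposition4 (K : realType) (n p : nat)
    (R : {ffun 'I_p.+1 -> 'M[K[i]]_n}) :
  trivial_centralizer R <->
  (forall Y : sl K[i] n,
     exists X : {ffun 'I_p.+1 -> 'M[K[i]]_n}, commutator_map R X = Y).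
Proof. exact: trivial_centralizer_surjective. Qed.
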